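(* Let $k\ge 1$ and $n\ge 1$ be integers, and let $A:[0,\infty)\to\mathbb{C}^{n\times n}$ be of class $\mathcal{C}^k$ with $A(t)^T=A(t)$ for all $t\ge 0$. Suppose that for every $t\ge 0$ the singular values of $A(t)$ are pairwise distinct and positive. Let $A(0)=U_0S_0U_0^T$ be a Takagi factorization at $t=0$. Let $U$ and $S$ be the $\mathcal{C}^k$ factors with $A(t)=U(t)S(t)U(t)^T$ for all $t\ge 0$, $U(t)$ unitary, $S(t)=\operatorname{diag}(\sigma_1(t),\dots,\sigma_n(t))$, $\sigma_1(t)>\dots>\sigma_n(t)>0$, $U(0)=U_0$, $S(0)=S_0$. Then $U$ and $S$ satisfy the differential equations $$\dot S=\operatorname{Re}\big(\operatorname{diag}(U^*\dot A\,\overline{U})\big),\qquad \dot U=UH,$$ where $H=U^*\dot U$ is the skew-Hermitian function such that $$H_{kk}=i\,\frac{\operatorname{Im}(U^*\dot A\,\overline U)_{kk}}{2\sigma_k},\qquad k=1,\dots,n,$$ $$H_{kj}=\frac{\operatorname{Re}(U^*\dot A\,\overline U)_{kj}}{\sigma_j-\sigma_k}+i\,\frac{\operatorname{Im}(U^*\dot A\,\overline U)_{kj}}{\sigma_j+\sigma_k},\qquad k=1,\dots,n,\ j=1,\dots,k-1.$$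
   Context: A Takagi factorization of a complex symmetric matrix $A$ is $A=USU^T$ with $U$ unitary and $S=\operatorname{diag}(\sigma_1,\dots,\sigma_n)$ the decreasingly ordered singular values of $A$. $U^T$ is the transpose, $\overline U$ the entrywise conjugate, $U^*=\overline{U}^T$; a dot denotes $d/dt$. For a matrix $X$, $\operatorname{diag}(X)$ denotes the diagonal matrix with the same diagonal as $X$, and $\operatorname{Re}$, $\operatorname{Im}$ are taken entrywise. Smooth factors $U,S$ as described exist and are uniquely determined by their values at $t=0$. *)

(* Defs.v *)
From HB Require Import structures.
From mathcomp Require Import all_boot all_order all_algebra.
From mathcomp Require Import complex.
From mathcomp Require Import all_classical all_reals all_analysis.

Set Implicit Arguments.
Unset Strict Implicit.
Unset Printing Implicit Defensive.

Import Order.TTheory GRing.Theory Num.Theory.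
Import numFieldNormedType.Exports.

Local Open Scope classical_set_scope.
Local Open Scope ring_scope.
Local Open Scope sesquilinear_scope.

(* R[i] carries no topology of its own in MathComp-Analysis; R[i]^o is the same
   field with the topology of its norm. *)

Section DerivativeOnHalfLine.
Variable R : realType.
Implicit Types (f : R -> R[i]^o) (t : R).

(* The difference quotient is only taken inside [0, +oo[, so that derivatives
   at 0 are one-sided and values at negative times are irrelevant. *)
Definition diff_quot f t : R -> R[i]^o :=
  fun s => ((s - t)%:C%C)^-1 * (f s - f t).

Definition derivable_ge0 f t : Prop :=
  cvg (diff_quot f t s @[s --> within `[0, +oo[ t^']).

Definition dot f : R -> R[i]^o :=
  fun t => lim (diff_quot f t s @[s --> within `[0, +oo[ t^']).

Fixpoint Ck (k : nat) f : Prop :=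
  if k is k'.+1 then (forall t, 0 <= t -> derivable_ge0 f t) /\ Ck k' (dot f)
  else {within `[0, +oo[, continuous f}.

Definition mx_Ck (k m n : nat) (A : R -> 'M[R[i]]_(m, n)) : Prop :=
  forall i j, Ck k (fun t => A t i j).

Definition mx_dot (m n : nat) (A : R -> 'M[R[i]]_(m, n)) :
    R -> 'M[R[i]]_(m, n) :=
  fun t => \matrix_(i, j) dot (fun s => A s i j) t.

End DerivativeOnHalfLine.

Section Takagi.
Variables (R : realType) (n : nat).
Implicit Types A U S X : 'M[R[i]]_n.

Definition conj_mx X : 'M[R[i]]_n := map_mx Num.conj X.

Definition re_mx X : 'M[R[i]]_n := map_mx (fun z => 'Re z) X.

Definition diag_part X : 'M[R[i]]_n := diag_mx (\row_i X i i).

(* The square roots of the eigenvalues of A^* A, with multiplicity, in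
   decreasing order. The entries of spectral_diag are the eigenvalues because
   A^* A is normal; they are real and nonnegative, so taking the real part only
   changes their type. *)
Definition singular_values A : seq R :=
  sort >=%R [seq Num.sqrt (complex.Re (spectral_diag (A^t* *m A) 0 i))
            | i <- enum 'I_n].

Definition takagi A U S : Prop :=
  [/\ U \is unitarymx,
      S = diag_mx (\row_i ((singular_values A)`_i)%:C%C)
    & A = U *m S *m U^T].

End Takagi.

(* Main.v *)
Require Import Defs.
From HB Require Import structures.
From mathcomp Require Import all_boot all_order all_algebra.
From mathcomp Require Import complex.
From mathcomp Require Import all_classical all_reals all_analysis.
Import Order.TTheory GRing.Theory Num.Theory.
Import numFieldNormedType.Exports.
Local Open Scope ring_scope.
Local Open Scope sesquilinear_scope.

(* Differentiating U^* U = 1 shows that H = U^* U' is skew-Hermitian, and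
   differentiating A = U S U^T gives, for M = U^* A' conj(U),
     M = H S + S' + S H^T.
   Since H_qp = - conj(H_pq), the (p, q) entry of this identity reads
     M_pq = sigma_q H_pq - sigma_p conj(H_pq) + S'_pq,
   with S' real and diagonal. Its real and imaginary parts can be solved
   separately because sigma_q - sigma_p (for p <> q) and sigma_q + sigma_p do
   not vanish. *)

Set Implicit Arguments.
Unset Strict Implicit.

(** * Differentiation rules for scalar functions on the half-line *)

Section ScalarDerivative.
Variables (R : realType) (t : R).
Implicit Types f g : R -> R[i]^o.

Local Notation F := (within `[0, +oo[%classic t^'%classic).

(** [dot] is a [lim], which has a default value when the quotient diverges. Here convergence is part
    of the statement, so that the rules below can be chained. *)
Definition is_dot f (l : R[i]^o) : Prop :=
  (diff_quot f t s @[s --> F] --> l)%classic.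

Lemma near_dnbhs_ge0 : \forall s \near F, 0 <= s /\ s != t.
Proof.
rewrite near_withinE /dnbhs near_withinE; apply: nearW => s st /=.
by rewrite in_itv /= andbT.
Qed.

Lemma cvg_eq_near f g (l : R[i]^o) : (\forall s \near F, f s = g s) ->
  (f s @[s --> F] --> l -> g s @[s --> F] --> l)%classic.
Proof. by move=> /near_eq_cvg fg fl; exact: cvg_trans fg fl. Qed.

Lemma is_dot_eq f g l : f =1 g -> is_dot f l -> is_dot g l.
Proof. by move=> /funext ->. Qed.

(** Identities such as the factorization of [A] are known only at nonnegative times. This is enough,
    since the quotient evaluates the function only at [t] and at points [s >= 0]. *)
Lemma is_dot_ge0_eq f g l : 0 <= t -> (forall s, 0 <= s -> f s = g s) ->
  is_dot f l -> is_dot g l.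
Proof.
move=> t_ge0 fg; apply: cvg_eq_near.
by near=> s; rewrite /diff_quot !fg //; have [] := near near_dnbhs_ge0 s.
Unshelve. all: by end_near. Qed.

Lemma is_dot_cst (c : R[i]^o) : is_dot (fun=> c) 0.
Proof.
apply: cvg_eq_near (cvg_cst (0 : R[i]^o)).
by apply: nearW => s; rewrite /diff_quot subrr mulr0.
Qed.

Lemma is_dotD f g l m : is_dot f l -> is_dot g m ->
  is_dot (fun s => f s + g s) (l + m).
Proof.
move=> fl gm; apply: cvg_eq_near (cvgD fl gm).
apply: nearW => s; rewrite /diff_quot /= -mulrDr; congr (_ * _).
by rewrite opprD addrACA.
Qed.

Lemma cvg_realC_sub : (((s - t)%:C%C : R[i]^o) @[s --> F] --> (0 : R[i]^o))%classic.
Proof.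
apply/cvgrPdist_lt => e e0.
(* The radius [e] lives in [R[i]], but [0 < e] forces it to be real, so the estimate can be made in
   [R]. *)
have eE : (complex.Re e)%:C%C = e by rewrite RRe_real ?gtr0_real.
rewrite -eE ltcR in e0 *.
have : \forall s \near F, `|t - s| < complex.Re e.
  exact/cvg_within/nbhs_dnbhs/nbhsx_ballx.
apply: filterS => s; rewrite sub0r normrN normc_def /= expr0n addr0.
by rewrite sqrtr_sqr distrC ltcR.
Qed.

(** Off [t], [f s] is [f t] plus [s - t] times the quotient, and the second term tends to
    [0 * l]. *)
Lemma is_dot_cvg f l : is_dot f l -> (f s @[s --> F] --> f t)%classic.
Proof.
move=> fl.
have : (f t + (s - t)%:C%C * diff_quot f t s @[s --> F] --> f t + 0 * l)%classic.
  by apply: cvgD; [exact: cvg_cst|apply: cvgM => //; exact: cvg_realC_sub].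
rewrite mul0r addr0; apply: cvg_eq_near.
near=> s; have [_ st] : 0 <= s /\ s != t by near: s; exact: near_dnbhs_ge0.
rewrite /diff_quot mulVKf; first by rewrite addrC subrK.
by rewrite -(rmorph0 (real_complex R)) (inj_eq (@complexI R)) subr_eq0.
Unshelve. all: by end_near. Qed.

Lemma is_dotM f g l m : is_dot f l -> is_dot g m ->
  is_dot (fun s => f s * g s) (l * g t + f t * m).
Proof.
move=> fl gm.
(* The increment splits as [(f s - f t) * g t + f s * (g s - g t)], so only the continuity of [f] is
   needed. *)
apply: cvg_eq_near
  (cvgD (cvgM fl (cvg_cst (g t))) (cvgM (is_dot_cvg fl) gm)).
apply: nearW => s; rewrite /diff_quot /=.
by rewrite [f s * (_ * _)]mulrCA -mulrA -mulrDr mulrBl mulrBr [X in _ * X]addrC subrKA.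
Qed.

Lemma is_dot_sum (I : Type) (r : seq I) (f : I -> R -> R[i]^o) l :
  (forall i, is_dot (f i) (l i)) ->
  is_dot (fun s => \sum_(i <- r) f i s) (\sum_(i <- r) l i).
Proof.
move=> fl; elim: r => [|i r IHr].
  rewrite big_nil; apply: is_dot_eq (is_dot_cst 0) => s.
  by rewrite big_nil.
rewrite big_cons; apply: is_dot_eq (is_dotD (fl i) IHr) => s.
by rewrite big_cons.
Qed.

(** Since [s - t] is real, conjugation commutes with the difference quotient; it also preserves the
    norm. *)
Lemma is_dot_conj f l : is_dot f l ->
  is_dot (fun s => Num.conj (f s)) (Num.conj l).
Proof.
have quotJ s : diff_quot (fun s => Num.conj (f s)) t s = Num.conj (diff_quot f t s).
  have real_st : (s - t)%:C%C \is Num.real by apply/complex_realP; exists (s - t).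
  have fJ : Num.conj (f s - f t) = Num.conj (f s) - Num.conj (f t).
    by rewrite rmorphB.
  by rewrite /diff_quot [RHS]rmorphM /= fmorphV /= (conj_Creal real_st) fJ.
move=> /cvgrPdist_lt fl; apply/cvgrPdist_lt => e /fl; apply: filterS => s.
by rewrite quotJ -norm_conjC rmorphB.
Qed.

Lemma dnbhs_ge0_proper : 0 <= t -> ProperFilter F.
Proof.
move=> t_ge0; split; last exact: within_filter.
(* A punctured ball of radius [e] around [t >= 0] contains the nonnegative point [t + e / 2], so the
   filter is proper and limits are unique. *)
rewrite /within /dnbhs /within /= => -[e /= e0 /(_ (t + e / 2))].
have e20 : 0 < e / 2 by rewrite divr_gt0.
apply.
- rewrite /ball_ /= opprD addNKr normrN gtr0_norm //.
  by rewrite ltr_pdivrMr // ltr_pMr // ltr1n.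
- by rewrite -subr_eq0 addrAC subrr add0r gt_eqF.
- by rewrite /= in_itv /= andbT addr_ge0 // ltW.
Qed.

Lemma is_dotE f l : 0 <= t -> is_dot f l -> dot f t = l.
Proof.
by move=> /dnbhs_ge0_proper ? fl; apply: cvg_lim fl; exact: norm_hausdorff.
Qed.

End ScalarDerivative.

(** * Matrix calculus and the differentiated factorization *)

Section MatrixDerivative.
Variables (R : realType) (t : R).

Definition mx_is_dot m n (A : R -> 'M[R[i]]_(m, n)) (L : 'M[R[i]]_(m, n)) :=
  forall i j, is_dot t (fun s => A s i j) (L i j).

Lemma mx_is_dotE m n (A : R -> 'M[R[i]]_(m, n)) L :
  0 <= t -> mx_is_dot A L -> mx_dot A t = L.
Proof. by move=> t_ge0 AL; apply/matrixP => i j; rewrite mxE; apply: is_dotE. Qed.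

Lemma mx_Ck_is_dot k m n (A : R -> 'M[R[i]]_(m, n)) :
  0 <= t -> (0 < k)%N -> mx_Ck k A -> mx_is_dot A (mx_dot A t).
Proof.
by case: k => // k t_ge0 _ A_Ck i j; rewrite mxE; have [+ _] := A_Ck i j; apply.
Qed.

Lemma mx_is_dot_ge0_eq m n (A B : R -> 'M[R[i]]_(m, n)) L :
  0 <= t -> (forall s, 0 <= s -> A s = B s) -> mx_is_dot A L -> mx_is_dot B L.
Proof.
by move=> t_ge0 AB AL i j; apply: (is_dot_ge0_eq t_ge0) (AL i j) => s s_ge0; rewrite AB.
Qed.

Lemma mx_is_dotM m n p (A : R -> 'M[R[i]]_(m, n)) (B : R -> 'M[R[i]]_(n, p)) L M :
  mx_is_dot A L -> mx_is_dot B M ->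
  mx_is_dot (fun s => A s *m B s) (L *m B t + A t *m M).
Proof.
move=> AL BM i j; rewrite !mxE -big_split /=.
apply: (@is_dot_eq _ _ (fun s => \sum_q A s i q * B s q j)) => [s|].
  by rewrite mxE.
by apply: is_dot_sum => q; apply: is_dotM.
Qed.

Lemma mx_is_dot_tr m n (A : R -> 'M[R[i]]_(m, n)) L :
  mx_is_dot A L -> mx_is_dot (fun s => (A s)^T) L^T.
Proof.
by move=> AL i j; rewrite mxE; apply: is_dot_eq (AL j i) => s; rewrite mxE.
Qed.

Lemma mx_is_dot_conj m n (A : R -> 'M[R[i]]_(m, n)) L :
  mx_is_dot A L -> mx_is_dot (fun s => map_mx Num.conj (A s)) (map_mx Num.conj L).
Proof.
move=> AL i j; rewrite mxE.
by apply: is_dot_eq (is_dot_conj (AL i j)) => s; rewrite mxE.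
Qed.

Lemma mx_is_dot_cst m n (C : 'M[R[i]]_(m, n)) : mx_is_dot (fun=> C) 0.
Proof. by move=> i j; rewrite mxE; exact: is_dot_cst. Qed.

Lemma unitarymx_dot_skew n (U : R -> 'M[R[i]]_n) L :
  0 <= t -> (forall s, 0 <= s -> U s \is unitarymx) -> mx_is_dot U L ->
  ((U t)^t* *m L)^t* = - ((U t)^t* *m L).
Proof.
move=> t_ge0 U_unitary UL.
have UUs s : 0 <= s -> 1%:M = (U s)^t* *m U s.
  by move=> /U_unitary /unitarymxP /mulmx1C.
(* The same product is differentiated as a constant and by the product rule; uniqueness of the
   derivative equates the results. *)
have UU_cst := mx_is_dot_ge0_eq t_ge0 UUs (mx_is_dot_cst 1%:M).
have UU_prod := mx_is_dotM (mx_is_dot_conj (mx_is_dot_tr UL)) UL.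
have := mx_is_dotE t_ge0 UU_prod; rewrite (mx_is_dotE t_ge0 UU_cst) => /esym/eqP.
by rewrite addr_eq0 => /eqP <-; rewrite trmx_mul map_mxM trmxCK.
Qed.

Lemma takagi_dot n (A U S : R -> 'M[R[i]]_n) A' U' S' :
  0 <= t -> (forall s, 0 <= s -> A s = U s *m S s *m (U s)^T) ->
  U t \is unitarymx ->
  mx_is_dot A A' -> mx_is_dot U U' -> mx_is_dot S S' ->
  let H := (U t)^t* *m U' in
  (U t)^t* *m A' *m conj_mx (U t) = H *m S t + S' + S t *m H^T.
Proof.
move=> t_ge0 A_fact U_unitary AA' UU' SS' H.
have USU := mx_is_dotM (mx_is_dotM UU' SS') (mx_is_dot_tr UU').
have UU : (U t)^t* *m U t = 1%:M by apply/mulmx1C/unitarymxP.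
(* This product is the transpose of [(U t)^t* *m U t]. *)
have UTU : (U t)^T *m conj_mx (U t) = 1%:M.
  by rewrite -[LHS]trmxK trmx_mul trmxK /conj_mx map_trmx UU trmx1.
have -> : A' = (U' *m S t + U t *m S') *m (U t)^T + U t *m S t *m U'^T.
  rewrite -(mx_is_dotE t_ge0 AA').
  by rewrite (mx_is_dotE t_ge0 (mx_is_dot_ge0_eq t_ge0 _ USU)) // => s /A_fact.
rewrite mulmxDr mulmxDl mulmxA -[X in X + _]mulmxA UTU mulmx1 mulmxDr.
rewrite !mulmxA UU mul1mx.
have -> : H^T = U'^T *m conj_mx (U t) by rewrite trmx_mul map_trmx trmxK.
by rewrite mul1mx mulmxA.
Qed.

Lemma mx_is_dot_diag n (S : R -> 'M[R[i]]_n) (sigma : 'I_n -> R -> R) S' :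
  0 <= t -> (forall s, 0 <= s -> S s = diag_mx (\row_i (sigma i s)%:C%C)) ->
  mx_is_dot S S' ->
  is_diag_mx S' /\ forall i, S' i i \is Num.real.
Proof.
move=> t_ge0 S_diag SS'; split=> [|i].
  apply/is_diag_mxP => i j ij.
  rewrite -(is_dotE t_ge0 (SS' i j)); apply: (is_dotE t_ge0).
  apply: (is_dot_ge0_eq t_ge0) (is_dot_cst t 0) => s /S_diag ->.
  by rewrite !mxE -(inj_eq val_inj) (negPf ij).
(* A diagonal entry of [S] equals its own conjugate, so its derivative does too; [sigma] itself is
   never differentiated. *)
apply/CrealP; rewrite -[RHS](is_dotE t_ge0 (SS' i i)).
apply/esym/(is_dotE t_ge0).
apply: (is_dot_ge0_eq t_ge0) (is_dot_conj (SS' i i)) => s /S_diag ->.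
rewrite !mxE eqxx mulr1n conj_Creal //.
by apply/complex_realP; exists (sigma i s).
Qed.

End MatrixDerivative.

(** Used with [z = H p q], [a] and [b] being the values of [sigma p] and [sigma q]. Conjugation
    changes the sign of the imaginary part only, hence a difference in one equation and a sum in the
    other. *)
Lemma Re_Im_skew_combination (C : numClosedFieldType) (z m a b : C) :
  a \is Num.real -> b \is Num.real -> m = z * b - a * z^* ->
  'Re m = 'Re z * (b - a) /\ 'Im m = 'Im z * (b + a).
Proof.
move=> a_real b_real ->.
rewrite !raddfB /= ReMr // ImMr // ReMl // ImMl // Re_conj Im_conj.
by rewrite mulrN opprK [a * _]mulrC [a * 'Im _]mulrC mulrBr mulrDr.
Qed.

Theorem theorem3p1 (R : realType) (k n : nat) (hk : (1 <= k)%N) (hn : (1 <= n)%N)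
    (A : R -> 'M[R[i]]_n)
    (A_Ck : mx_Ck k A)
    (A_sym : forall t : R, 0 <= t -> (A t)^T = A t)
    (A_sv : forall t : R, 0 <= t ->
      uniq (singular_values (A t)) /\
      (forall s : R, s \in singular_values (A t) -> 0 < s))
    (U0 S0 : 'M[R[i]]_n)
    (A0_takagi : takagi (A 0) U0 S0)
    (U S : R -> 'M[R[i]]_n) (sigma : 'I_n -> R -> R)
    (U_Ck : mx_Ck k U) (S_Ck : mx_Ck k S)
    (A_fact : forall t : R, 0 <= t -> A t = U t *m S t *m (U t)^T)
    (U_unitary : forall t : R, 0 <= t -> U t \is unitarymx)
    (S_diag : forall t : R, 0 <= t -> S t = diag_mx (\row_i (sigma i t)%:C%C))
    (sigma_decr : forall (t : R) (p q : 'I_n), 0 <= t -> (p < q)%N ->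
      sigma q t < sigma p t)
    (sigma_gt0 : forall (t : R) (p : 'I_n), 0 <= t -> 0 < sigma p t)
    (U_init : U 0 = U0) (S_init : S 0 = S0) :
  forall t : R, 0 <= t ->
    let M := (U t)^t* *m mx_dot A t *m conj_mx (U t) in
    let H := (U t)^t* *m mx_dot U t in
    [/\ mx_dot S t = re_mx (diag_part M),
        mx_dot U t = U t *m H,
        H^t* = - H,
        (forall p : 'I_n,
           H p p = 'i * ('Im (M p p) / (2 * (sigma p t)%:C%C)))
      & (forall p q : 'I_n, (q < p)%N ->
           H p q = 'Re (M p q) / (sigma q t - sigma p t)%:C%C
                   + 'i * ('Im (M p q) / (sigma q t + sigma p t)%:C%C))].
Proof.
move=> t t_ge0 M H.
have U_dot := mx_Ck_is_dot t_ge0 hk U_Ck.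
have S_dot := mx_Ck_is_dot t_ge0 hk S_Ck.
have A_dot := mx_Ck_is_dot t_ge0 hk A_Ck.
have [S'_diag S'_real] := mx_is_dot_diag t_ge0 S_diag S_dot.
have H_skew : H^t* = - H by exact: unitarymx_dot_skew t_ge0 U_unitary U_dot.
have HJ p q : H q p = - (H p q)^*.
  have /matrixP/(_ q p) := H_skew.
  by rewrite [LHS]mxE [H^T q p]mxE [RHS]mxE => ->; rewrite opprK.
have real_C r : r%:C%C \is (@Num.real R[i]) by apply/complex_realP; exists r.
have M_eq : M = H *m S t + mx_dot S t + S t *m H^T.
  exact: takagi_dot t_ge0 A_fact (U_unitary t t_ge0) A_dot U_dot S_dot.
(* The entry of [S t *m H^T] involves [H q p], which [HJ] expresses through [H p q]. *)
have M_entry p q : M p q =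
    H p q * (sigma q t)%:C%C - (sigma p t)%:C%C * (H p q)^* + mx_dot S t p q.
  rewrite M_eq S_diag // mul_mx_diag mul_diag_mx.
  (* H and mx_dot S t are generalized so that mxE does not unfold them. *)
  move: H (mx_dot S t) HJ {M_eq H_skew S'_diag S'_real S_dot} => X Y XJ.
  by rewrite !mxE (XJ p q) mulrN addrAC.
have M_part p q :
    'Re (M p q - mx_dot S t p q) = 'Re (H p q) * ((sigma q t)%:C%C - (sigma p t)%:C%C) /\
    'Im (M p q - mx_dot S t p q) = 'Im (H p q) * ((sigma q t)%:C%C + (sigma p t)%:C%C).
  by apply: Re_Im_skew_combination => //; rewrite M_entry addrK.
have sigma_sum_neq0 p q : (sigma q t)%:C%C + (sigma p t)%:C%C != 0 :> R[i].
  by rewrite gt_eqF // addr_gt0 // ltcR sigma_gt0.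
split=> // [||p|p q qp].
- apply/matrixP => p q; rewrite [RHS]mxE [diag_part M p q]mxE [(\row_i _) _ _]mxE.
  have [<-|pq] := eqVneq p q; last first.
    by rewrite mulr0n raddf0; move/is_diag_mxP: S'_diag; apply.
  (* On the diagonal the factor of ['Re (H p p)] is zero, which leaves ['Re (M p p)] equal to the
     real number [mx_dot S t p p]. *)
  have [+ _] := M_part p p; rewrite subrr mulr0 raddfB /= (Creal_ReP _ (S'_real p)).
  by move/eqP; rewrite subr_eq0 => /eqP ->.
- by rewrite mulmxA (unitarymxP (U_unitary t t_ge0)) mul1mx.
(* [M p p] carries no information on this real part, because its coefficient vanishes;
   skew-Hermitian symmetry determines it instead. *)
- have ReH0 : 'Re (H p p) = 0.
    have /eqP := congr1 (fun z => 'Re z) (HJ p p).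
    by rewrite raddfN /= Re_conj -addr_eq0 -mulr2n mulrn_eq0 => /eqP.
  have [_ +] := M_part p p; rewrite raddfB /= (Creal_ImP _ (S'_real p)) subr0 => ->.
  by rewrite mulr_natl mulr2n mulfK // [LHS]Crect ReH0 add0r.
- have S'0 : mx_dot S t p q = 0.
    by move/is_diag_mxP: S'_diag; apply; rewrite gtn_eqF.
  have [] := M_part p q; rewrite S'0 subr0 => -> ->.
  rewrite rmorphB rmorphD /= !mulfK // -?Crect //.
  (* Distinctness of the singular values enters here: [q < p] gives [sigma p t < sigma q t]. *)
  by rewrite subr_eq0 gt_eqF // ltcR sigma_decr.
Qed.
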